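(* Suppose $G$ is a topological groupoid such that: (1) the unit space $G^{(0)}$ is a complete metric space; (2) $G$ has a countable cover consisting of neighbourhood bisections. If $G$ is effective, then $G$ is topologically principal.
   Context: A groupoid $G$ is a small category in which every morphism is invertible; $G$ is identified with its set of morphisms. The set of objects is identified with the set of identity morphisms and is denoted $G^{(0)}\subseteq G$ (the unit space). For $\gamma\in G$, $r(\gamma)$ and $s(\gamma)$ denote the range and source of $\gamma$, so $r,s:G\to G^{(0)}\subseteq G$. Put $G^{(2)}:=\{(\gamma,\eta)\in G\times G: r(\eta)=s(\gamma)\}$, the set of composable pairs. For $x\in G^{(0)}$, the isotropy group at $x$ is $xGx:=\{\gamma\in G: r(\gamma)=s(\gamma)=x\}$, and $\operatorname{Iso}(G):=\bigcup_{x\in G^{(0)}} xGx$. For $B\subseteq G$, $\operatorname{Iso}(B):=\operatorname{Iso}(G)\cap B$. A topological groupoid is a groupoid $G$ equipped with a topology so that composition $G^{(2)}\to G$ and inversion $G\to G$ are continuous ($G^{(2)}$ carries the subspace topology from $G\times G$). That $G^{(0)}$ is a complete metric space means that its topology as a subspace of $G$ is the topology of a complete metric. An open set $A\subseteq G$ is an open bisection if $r(A)$ and $s(A)$ are open in $G$ and $r|_A$ and $s|_A$ are homeomorphisms onto their images (in particular, $r$ and $s$ are injective on $A$). Write $\operatorname{Int}(D)$ for the interior of a set $D\subseteq G$ and $\overline{D}$ for its closure. A set $B\subseteq G$ is a neighbourhood bisection if: (1) $B\subseteq\overline{\operatorname{Int}(B)}$; (2) $r|_B$ and $s|_B$ are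 injective; (3) $r(B)$ and $s(B)$ are open in $G$; (4) $\operatorname{Int}(B)$ is an open bisection; (5) $B-\operatorname{Int}(B)\subseteq\operatorname{Iso}(B)-G^{(0)}$. $G$ is effective if $\operatorname{Iso}(G)-G^{(0)}$ has empty interior in $G$. $G$ is topologically principal if $\{x\in G^{(0)}: xGx\neq\{x\}\}$ has empty interior in $G^{(0)}$. *)

(* Defs.v *)
From HB Require Import structures.
From mathcomp Require Import all_boot all_order all_algebra.
From mathcomp Require Import all_classical all_reals all_analysis.
Set Implicit Arguments.
Unset Strict Implicit.
Unset Printing Implicit Defensive.
Local Open Scope classical_set_scope.

(* A groupoid, given by its set of morphisms: [rng g] and [src g] are the
   identity morphisms at the range and at the source of [g].  The value
   [gmul g h] is meaningful only when [src g = rng h] and is left arbitrary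
   on the other pairs. *)
HB.mixin Record isGroupoid (G : Type) := {
  rng : G -> G;
  src : G -> G;
  ginv : G -> G;
  gmul : G -> G -> G;
  rng_rng : forall g, rng (rng g) = rng g;
  src_rng : forall g, src (rng g) = rng g;
  rng_src : forall g, rng (src g) = src g;
  src_src : forall g, src (src g) = src g;
  rng_gmul : forall g h, src g = rng h -> rng (gmul g h) = rng g;
  src_gmul : forall g h, src g = rng h -> src (gmul g h) = src h;
  gmulA : forall g h k, src g = rng h -> src h = rng k ->
    gmul g (gmul h k) = gmul (gmul g h) k;
  gmul_rng : forall g, gmul (rng g) g = g;
  gmul_src : forall g, gmul g (src g) = g;
  rng_ginv : forall g, rng (ginv g) = src g;
  src_ginv : forall g, src (ginv g) = rng g;
  gmul_ginv : forall g, gmul g (ginv g) = rng g;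
  ginv_gmul : forall g, gmul (ginv g) g = src g
}.

#[short(type="groupoidType")]
HB.structure Definition Groupoid := {G of isGroupoid G}.

Definition composable (G : groupoidType) : set (G * G) :=
  [set p | src p.1 = rng p.2].
Arguments composable G : clear implicits.

Definition units (G : groupoidType) : set G := range rng.
Arguments units G : clear implicits.

Definition isotropy (G : groupoidType) (x : G) : set G :=
  [set g | rng g = x /\ src g = x].

Definition Iso (G : groupoidType) : set G :=
  \bigcup_(x in units G) isotropy x.
Arguments Iso G : clear implicits.

HB.mixin Record isTopologicalGroupoid G of Topological G & isGroupoid G := {
  gmul_continuous :
    {within composable G, continuous (fun p : G * G => gmul p.1 p.2)};
  ginv_continuous : continuous (ginv : G -> G)
}.

#[short(type="topGroupoidType")]
HB.structure Definition TopologicalGroupoid :=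
  {G of Topological G & isGroupoid G & isTopologicalGroupoid G}.

(* [m] is a metric space structure on the carrier of [X], a priori with its own
   topology; the first conjunct says that it is the given one. *)
Definition topology_of_complete_metric (R : realType) (X : topologicalType) :
    Prop :=
  exists m : Metric.axioms_ R X, let M : metricType R := Metric.Pack m in
    (@open M = @open X) /\
    (forall u : nat -> M, cauchy (u @ \oo) -> exists l : M, u @ \oo --> l).

Definition homeo_onto_image (X Y : topologicalType) (A : set X) (f : X -> Y) :
    Prop :=
  {within A, continuous f} /\
  exists g : Y -> X, {in A, cancel f g} /\ {within f @` A, continuous g}.

Section Bisections.
Variable G : topGroupoidType.
Implicit Types A B : set G.

Definition open_bisection A : Prop :=
  [/\ open A, open (rng @` A), open (src @` A),
      homeo_onto_image A rng & homeo_onto_image A src].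

Definition neighbourhood_bisection B : Prop :=
  [/\ B `<=` closure B°,
      set_inj B rng /\ set_inj B src,
      open (rng @` B) /\ open (src @` B),
      open_bisection B° &
      B `\` B° `<=` (Iso G `&` B) `\` units G].

End Bisections.

Definition effective (G : topGroupoidType) : Prop :=
  (Iso G `\` units G)° = set0.

(* The interior is taken in the type [units G], which carries the subspace
   topology. *)
Definition topologically_principal (G : topGroupoidType) : Prop :=
  [set x : units G | isotropy (\val x) <> [set \val x]]° = set0.

(* Main.v *)
Require Import Defs.
From HB Require Import structures.
From mathcomp Require Import all_boot all_order all_algebra.
From mathcomp Require Import all_classical all_reals all_analysis.
Set Implicit Arguments.
Unset Strict Implicit.
Unset Printing Implicit Defensive.
Local Open Scope classical_set_scope.

Import Order.TTheory GRing.Theory Num.Theory.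

(** A unit [x] has nontrivial isotropy exactly when some member [B] of the
countable cover contains a nonunit isotropy element with range [x]. So the set
of bad units is a countable union, over the members [B] of the cover, of the
ranges [E B] of the nonunit isotropy elements of [B], and by the Baire category
theorem in the complete metric space of units ([dense_countable_bigcap]) it is
enough that each [E B] is nowhere dense.

Nowhere density means that every nonempty open set [W] of units contains a
nonempty open [V] disjoint from [E B] ([avoid_nontrivial_isotropy]). If no
element of [B] has its range in [W], then [V := W] works. Otherwise, as [B] lies
in the closure of its interior and [rng] is continuous, the set [S] of elements
of the interior of [B] with range in [W] is open and nonempty. Effectiveness
forbids that [S] consists of nonunit isotropy elements. The others form an open
set [T], because the isotropy is closed when the units are Hausdorff
([open_nonIso]) and the units are open in the groupoid ([open_units]).
Then [V := rng @` T] is open since the interior of [B] is a bisection, and it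
misses [E B] since [rng] is injective on all of [B], including the points of [B]
outside its interior. *)

(** * The Baire category theorem in complete metric spaces *)

Section Baire.
Local Open Scope ring_scope.

(** Choose balls of radius [r_n] tending to 0 so that the concentric ball of
radius [2 r_n] lies in the previous ball and in the prescribed open set. The
doubling replaces closed balls: the limit of the centres need not stay in the
ball of radius [r_n], but it stays in the one of radius [2 r_n]. *)
Lemma baire_pseudometric (R : realType) (M : pseudoMetricType R)
    (complete : forall u : nat -> M, cauchy (u @ \oo) ->
      exists l : M, u @ \oo --> l)
    (F : nat -> set M) :
  (forall i, open (F i) /\ dense (F i)) -> dense (\bigcap_i F i).
Proof.
move=> odF D D0 oD.
have small_ball (U : set M) x : open U -> U x ->
    exists2 e : {posnum R}, true & ball x (e%:num + e%:num) `<=` U.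
  rewrite openE => oU /oU /nbhs_ballP [e /= e0 eU].
  exists (PosNum (divr_gt0 e0 (ltr0n R 2))) => //=.
  by rewrite -splitr.
pose P n (p q : M * {posnum R}) :=
  ball q.1 (q.2%:num + q.2%:num) `<=` ball p.1 p.2%:num `&` F n /\
  (q.2%:num < n.+1%:R^-1).
have step (np : nat * (M * {posnum R})) : exists q, P np.1 np.2 q.
  case: np => n [x e] /=.
  have oB : open ((ball x e%:num)°) by exact: open_interior.
  have B0 : (ball x e%:num)° !=set0.
    by exists x; apply: nbhsx_ballx.
  have [oFn dFn] := odF n.
  have [y yBF] := dFn _ B0 oB.
  have [d _ dB] := small_ball _ _ (openI oB oFn) yBF.
  have n0 : (0 < n.+2%:R^-1 :> R) by rewrite invr_gt0.
  have m0 : (0 < Num.min d%:num n.+2%:R^-1) by rewrite lt_min n0 andbT.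
  exists (y, PosNum m0); split => /=.
    apply: subset_trans (subset_trans dB _).
      by apply: le_ball; apply: lerD; rewrite ge_min lexx.
    by move=> z [/interior_subset].
  rewrite (@le_lt_trans _ _ n.+2%:R^-1) ?ge_min ?lexx ?orbT//.
  by rewrite ltf_pV2 ?posrE ?ltr0n// ltr_nat.
have [f Pf] := choice step.
have [x0 Dx0] := D0.
have [e0 _ e0D] := small_ball _ _ oD Dx0.
pose fix p n := if n is k.+1 then f (k, p k) else (x0, e0).
have pS n : P n (p n) (p n.+1) by exact: (Pf (n, p n)).
have nested n m : (n <= m)%N ->
    ball (p m).1 (p m).2%:num `<=` ball (p n).1 (p n).2%:num.
  elim: m => [|m IH]; first by rewrite leqn0 => /eqP ->.
  rewrite leq_eqVlt => /orP[/eqP -> //|/IH]; apply: subset_trans.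
  have [+ _] := pS m; rewrite subsetI => -[+ _]; apply: subset_trans.
  by apply: le_ball; rewrite lerDl.
have tail n m : (n <= m)%N -> ball (p n).1 (p n).2%:num (p m).1.
  by move=> nm; apply: (nested _ _ nm); exact: ballxx.
have [|l pl] := complete (fun n => (p n).1).
  apply: cauchy_exP => e e_gt0.
  have [n ne] : exists n, (n.+1%:R^-1 < e).
    exists (Num.truncn e^-1).
    by rewrite -ltf_pV2 ?posrE ?invr_gt0 ?ltr0n// invrK truncnS_gt.
  exists (p n.+1).1; exists n.+1 => // m /= nm.
  apply: le_ball (tail _ _ nm).
  by have [_ /lt_trans/(_ ne)/ltW] := pS n.
have l_in n : ball (p n).1 ((p n).2%:num + (p n).2%:num) l.
  have [N _ lN] := pl _ (nbhsx_ballx l (p n).2%:num ltac:(by [])).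
  apply: ball_triangle (tail _ _ (leq_maxl n N)) _; apply: ball_sym.
  by apply: lN => /=; exact: leq_maxr.
exists l; split; first exact/e0D/(l_in 0%N).
by move=> n _; have [/(_ _ (l_in n.+1)) []] := pS n.
Qed.

End Baire.

(** The topology of [X] and that of the metric structure on its carrier are only
propositionally equal, so the Baire property is transported along the equality
of their open sets. *)
Lemma dense_countable_bigcap (R : realType) (X : topologicalType)
    (complete : topology_of_complete_metric R X)
    (I : Type) (C : set I) (F : I -> set X) :
  countable C -> (forall i, C i -> open (F i) /\ dense (F i)) ->
  dense (\bigcap_(i in C) F i).
Proof.
have [m [mE cplt]] := complete.
move=> /pfcard_geP[->|[h]] odF.
  by rewrite bigcap_set0 => U U0 _; rewrite setIT.
have baire := @baire_pseudometric R (Metric.Pack m) cplt (F \o h).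
move=> U U0 oU.
have /baire : forall i, @open (Metric.Pack m) ((F \o h) i) /\
    @dense (Metric.Pack m) ((F \o h) i).
  move=> i; have [oF dF] := odF (h i) (@funS _ _ _ _ h i Logic.I).
  by split; [rewrite mE|move=> V V0; rewrite mE; exact: dF].
move=> /(_ U U0); rewrite mE => /(_ oU) [x [Ux Fx]].
exists x; split=> // i /(@surj _ _ _ _ h) [n _ <-]; exact: Fx.
Qed.

Lemma complete_metric_hausdorff (R : realType) (X : topologicalType) :
  topology_of_complete_metric R X -> hausdorff_space X.
Proof.
move=> [m [mE _]] x y xy.
apply: (@metric_hausdorff R (Metric.Pack m)) => A B.
rewrite !nbhsE => -[U [oU Ux] UA] [V [oV Vy] VB].
have [|| z [Uz Vz]] := xy U V; last by exists z; split; [exact: UA|exact: VB].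
  by apply: open_nbhs_nbhs; split => //; rewrite -mE.
by apply: open_nbhs_nbhs; split => //; rewrite -mE.
Qed.

(** * Topological groupoids *)

(** The image of [S] is the preimage of [S] under the continuous inverse of [f],
cut down to the open set [f @` A]. *)
Lemma open_homeo_image (X Y : topologicalType) (A S : set X) (f : X -> Y) :
  homeo_onto_image A f -> open (f @` A) -> open S -> S `<=` A ->
  open (f @` S).
Proof.
move=> [_ [g [fK /continuousP cg]]] ofA oS SA.
have -> : f @` S = g @^-1` S `&` f @` A.
  rewrite eqEsubset; split=> [_ [x Sx <-]|y [/= Sy [x Ax xy]]].
    by split; [rewrite /= fK//; exact/mem_set/SA|exists x => //; exact: SA].
  by move: Sy; rewrite -xy fK ?inE// => Sx; exists x.
by have := cg _ oS; rewrite -open_setIS.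
Qed.

Section TopologicalGroupoid.
Variable G : topGroupoidType.
Implicit Types (B W : set G) (g : G).

(** The range map is [g] times its inverse. *)
Lemma rng_continuous : continuous (rng : G -> G).
Proof.
have -> : (rng : G -> G) = (fun p : G * G => gmul p.1 p.2) \o
    (fun g => (g, ginv g)).
  by apply/funext => g /=; rewrite gmul_ginv.
move=> g.
have comp_g h : composable G (h, ginv h) by rewrite /composable /= rng_ginv.
have /subspace_continuousP/(_ _ (comp_g g)) cm := @gmul_continuous G.
move=> U /cm Ug.
have {Ug} nU : nbhs (g, ginv g)
  [set p | composable G p -> U (gmul p.1 p.2)] := Ug.
have cpair : (fun h : G => (h, ginv h)) @ g --> (g, ginv g).
  by apply: cvg_pair; [exact: cvg_id|exact: ginv_continuous].
have := cpair _ nU; rewrite !nbhs_simpl /=; apply: filterS => h; exact.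
Qed.

Lemma src_continuous : continuous (src : G -> G).
Proof.
have -> : (src : G -> G) = rng \o ginv.
  by apply/funext => g /=; rewrite rng_ginv.
by move=> g; apply: continuous_comp;
  [exact: ginv_continuous|exact: rng_continuous].
Qed.

Lemma rng_unit g : units G (rng g). Proof. by exists g. Qed.

Lemma src_unit g : units G (src g).
Proof. by exists (src g) => //; rewrite rng_src. Qed.

Lemma IsoE : Iso G = [set g | rng g = src g].
Proof.
rewrite eqEsubset; split=> [g [x _ [/= -> ->]] //|g /= gE].
by exists (rng g); [exact: rng_unit|].
Qed.

(** The isotropy is the equalizer of the continuous maps [rng] and [src] into
the units, so it is closed as soon as the units are Hausdorff; [G] itself may
fail to be Hausdorff. *)
Lemma open_nonIso : hausdorff_space (units G) -> open (~` Iso G).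
Proof.
rewrite open_hausdorff => sep.
rewrite openE => g; rewrite IsoE /= => rs.
pose x : units G := exist _ (rng g) (mem_set (rng_unit g)).
pose y : units G := exist _ (src g) (mem_set (src_unit g)).
have xy : x != y by apply/eqP => /(congr1 val).
have [[U' V'] /= [xU yV] [[U oU UE] [V oV VE] /eqP UV]] := sep x y xy.
move: xU yV UV; rewrite -{U'}UE -{V'}VE !inE /= => Ux Vy UV.
have oN : open (rng @^-1` U `&` src @^-1` V).
  apply: openI; first by move/continuousP : rng_continuous; exact.
  by move/continuousP : src_continuous; exact.
apply: filterS (open_nbhs_nbhs (conj oN (conj Ux Vy))) => h /= [Uh Vh] hE.
have : set0 (exist _ (rng h) (mem_set (rng_unit h)) : units G) by
  rewrite -UV; split => //=; rewrite /set_val /= hE.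
by [].
Qed.

Lemma open_units (C : set (set G)) :
  (forall B, C B -> open (rng @` B)) -> \bigcup_(B in C) B = setT ->
  open (units G).
Proof.
move=> oC CT.
have -> : units G = \bigcup_(B in C) (rng @` B).
  by rewrite -image_bigcup CT.
exact: bigcup_open.
Qed.

(** This is nowhere density, in the units, of the ranges of the nonunit isotropy
elements of [B]. Were [V] not to exist, the elements of the interior of [B] with
range in [W] would form a nonempty open set of nonunit isotropy. *)
Lemma avoid_nontrivial_isotropy B W :
  hausdorff_space (units G) -> open (units G) -> effective G ->
  neighbourhood_bisection B -> open W -> W !=set0 ->
  exists V, [/\ open V, V !=set0, V `<=` W &
    forall g, B g -> (Iso G `\` units G) g -> ~ V (rng g)].
Proof.
move=> hU oU eff [BcD [injr _] _ [oD orD _ hr _] _] oW [w Ww].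
have [[b [Bb bw]]|noB] := pselect (exists b, B b /\ W (rng b)); last first.
  by exists W; split=> //; [exists w|move=> g Bg _ Wg; apply: noB; exists g].
have orW : open (rng @^-1` W).
  by move/continuousP : rng_continuous; exact.
pose S := B° `&` rng @^-1` W.
have oS : open S by exact: openI.
have [s Ss] : S !=set0 by apply: (BcD _ Bb); exact: open_nbhs_nbhs.
pose T := S `&` (~` Iso G `|` units G).
have oT : open T by apply: openI => //; apply: openU => //; exact: open_nonIso.
have [t Tt] : T !=set0.
  apply/set0P/eqP => T0.
  have : (Iso G `\` units G)° s.
    apply: filterS (open_nbhs_nbhs (conj oS Ss)) => h Sh.
    have nT : ~ T h by rewrite T0.
    split=> [|uh]; last by apply: nT; split; [|right].
    by apply: contrapT => nIh; apply: nT; split; [|left].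
  by rewrite eff.
exists (rng @` T); split.
- by apply: (open_homeo_image hr orD oT) => h [[]].
- by exists (rng t), t.
- by move=> _ [h [[_ Wh] _] <-].
move=> g Bg [Ig ug] [h [[Dh _] +] hg].
have -> : h = g by apply: injr; rewrite ?inE//; exact: interior_subset.
by case.
Qed.

End TopologicalGroupoid.

Theorem theorem3p4 (R : realType) (G : topGroupoidType)
    (complete_units : topology_of_complete_metric R (units G))
    (countable_cover : exists C : set (set G),
      [/\ countable C,
          forall B, C B -> neighbourhood_bisection B &
          \bigcup_(B in C) B = setT]) :
  effective G -> topologically_principal G.
Proof.
move=> eff.
have [C [cC nbC CT]] := countable_cover.
have hU := complete_metric_hausdorff complete_units.
have oU : open (units G).
  by apply: (open_units _ CT) => B /nbC [_ _ []].
pose E B : set (units G) :=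
  [set x | exists g, [/\ B g, (Iso G `\` units G) g & rng g = val x]].
have dense_E B : C B -> open ((~` E B)°) /\ dense ((~` E B)°).
  move=> /nbC nbB; split; first exact: open_interior.
  (* [W'] is the trace on the units of an open set [W] of [G]. *)
  move=> W' [x Wx] [W oW WE]; rewrite -{W'}WE in Wx *.
  have [||V [oV [v Vv] VW avoidV]] :=
      avoid_nontrivial_isotropy hU oU eff nbB (W := W `&` units G).
  - exact: openI.
  - by exists (val x); split; [|exact: set_mem (valP x)].
  have [Wv uv] := VW _ Vv.
  pose v' : units G := exist _ v (mem_set uv).
  exists v'; split; first by [].
  have oV' : open (val @^-1` V : set (units G)) by exists V.
  have Vv' : (val @^-1` V) v' by [].
  apply: filterS (open_nbhs_nbhs (conj oV' Vv')).
  by move=> y /= Vy [g [Bg Ig gy]]; apply: (avoidV g Bg Ig); rewrite gy.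
apply: contrapT => /eqP/set0P N0.
have [x [/interior_subset /= Nx Ex]] :=
  dense_countable_bigcap complete_units cC dense_E N0 (open_interior _).
apply: Nx; rewrite eqEsubset; split=> [g [rg sg]|_ ->]; last first.
  have [h _ <-] := set_mem (valP x).
  by split; rewrite ?rng_rng ?src_rng.
apply: contrapT => gx.
have [B CB Bg] : (\bigcup_(B in C) B) g by rewrite CT.
apply: (interior_subset (Ex B CB)); exists g; split=> //.
split; first by rewrite IsoE /= rg sg.
by move=> [h _ hg]; apply: gx; rewrite /= -rg -hg rng_rng.
Qed.
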